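(* Let $K$ be a compact line (not necessarily separable) and let $L$ be a countable discrete extension of $K$. If $\eta(K,L)<\infty$, then $\eta(K,L)$ is an odd natural number.
   Context: All topological spaces are Hausdorff. A compact line is a compact space whose topology is the order topology of some linear order. A countable discrete extension of a compact space $K$ is a compact space $L\supseteq K$ (containing $K$ as a subspace) such that $L\setminus K$ is a countably infinite discrete set. $C(K)$ is the Banach space of real-valued continuous functions on $K$ with the supremum norm. For compact spaces $K\subseteq L$, an extension operator is a bounded linear operator $E:C(K)\to C(L)$ such that $(Ef)|_K=f$ for every $f\in C(K)$. $\eta(K,L)$ denotes the infimum of the norms of all extension operators $E:C(K)\to C(L)$, with $\eta(K,L)=\infty$ if there is no such (bounded) operator. *)

(* Defs.v *)
From HB Require Import structures.
From mathcomp Require Import all_boot all_order all_algebra.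
From mathcomp Require Import all_classical all_reals all_analysis.

Set Implicit Arguments.
Unset Strict Implicit.
Unset Printing Implicit Defensive.

Import Order.TTheory GRing.Theory Num.Theory.
Import numFieldNormedType.Exports.

Local Open Scope classical_set_scope.
Local Open Scope card_scope.
Local Open Scope ring_scope.

(* The space C(K). The proof of compactness is a parameter because the supremum
   norm, with which this type is equipped below, is a norm only when continuous
   functions are bounded. *)
Definition cspace (R : realType) (K : topologicalType)
  (cK : compact [set: K]) : Type := continuousType K R.

Definition cspace_fun (R : realType) (K : topologicalType)
  (cK : compact [set: K]) (f : cspace R cK) : K -> R :=
  (f : continuousType K R).

Coercion cspace_fun : cspace >-> Funclass.

Section CSpace.
Context {R : realType} {K : topologicalType} (cK : compact [set: K]).
Local Notation C := (cspace R cK).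
Implicit Types (f g : C) (a b : R).

Lemma cspace_continuous f : continuous (f : K -> R).
Proof. exact: (@cts_fun _ _ (f : continuousType K R)). Qed.

Definition to_cspace (f : K -> R) (cf : continuous f) : C :=
  (mkcts cf : continuousType K R).

Lemma to_cspaceE (f : K -> R) (cf : continuous f) (x : K) :
  to_cspace cf x = f x.
Proof. by []. Qed.

Lemma cspaceP f g : (forall x, f x = g x) -> f = g.
Proof. by move=> fg; apply/(@continuousEP _ _ f g). Qed.

HB.instance Definition _ := gen_eqMixin C.
HB.instance Definition _ := gen_choiceMixin C.

Lemma cspace_zero_continuous : continuous (fun _ : K => 0 : R).
Proof. exact: cst_continuous. Qed.

Lemma cspace_add_continuous f g : continuous (fun x => f x + g x).
Proof. by move=> x; apply: cvgD; exact: cspace_continuous. Qed.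

Lemma cspace_opp_continuous f : continuous (fun x => - f x).
Proof. by move=> x; apply: cvgN; exact: cspace_continuous. Qed.

Lemma cspace_scale_continuous a f : continuous (fun x => a * f x).
Proof.
by move=> x; apply: cvgM; [exact: cvg_cst | exact: cspace_continuous].
Qed.

Definition cspace_zero : C := to_cspace cspace_zero_continuous.
Definition cspace_add f g : C := to_cspace (cspace_add_continuous (f:=f) (g:=g)).
Definition cspace_opp f : C := to_cspace (cspace_opp_continuous (f:=f)).
Definition cspace_scale a f : C :=
  to_cspace (cspace_scale_continuous (a:=a) (f:=f)).

Lemma cspace_addA : associative cspace_add.
Proof. by move=> f g h; apply: cspaceP => x; exact: addrA. Qed.

Lemma cspace_addC : commutative cspace_add.
Proof. by move=> f g; apply: cspaceP => x; exact: addrC. Qed.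

Lemma cspace_add0 : left_id cspace_zero cspace_add.
Proof. by move=> f; apply: cspaceP => x; exact: add0r. Qed.

Lemma cspace_addN : left_inverse cspace_zero cspace_opp cspace_add.
Proof. by move=> f; apply: cspaceP => x; exact: addNr. Qed.

HB.instance Definition _ :=
  GRing.isZmodule.Build C cspace_addA cspace_addC cspace_add0 cspace_addN.

Lemma cspace_scaleA a b f :
  cspace_scale a (cspace_scale b f) = cspace_scale (a * b) f.
Proof. by apply: cspaceP => x; exact: mulrA. Qed.

Lemma cspace_scale1 : left_id 1 cspace_scale.
Proof. by move=> f; apply: cspaceP => x; exact: mul1r. Qed.

Lemma cspace_scaleDr : right_distributive cspace_scale +%R.
Proof. by move=> a f g; apply: cspaceP => x; exact: mulrDr. Qed.

Lemma cspace_scaleDl f : {morph cspace_scale^~ f : a b / a + b}.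
Proof. by move=> a b; apply: cspaceP => x; exact: mulrDl. Qed.

HB.instance Definition _ := GRing.Zmodule_isLmodule.Build R C
  cspace_scaleA cspace_scale1 cspace_scaleDr cspace_scaleDl.

(* When K is empty, sup set0 = 0 is the right value. *)
Definition sup_norm f : R := sup [set `|f x| | x in [set: K]].

Lemma sup_norm_has_ubound f : has_ubound [set `|f x| | x in [set: K]].
Proof.
have /compact_bounded[M [_ MP]] : compact (range (f : K -> R)).
  apply: continuous_compact => //; apply: continuous_subspaceT.
  exact: cspace_continuous.
exists (M + 1) => _ [x _ <-]; apply: (MP (M + 1)); last by exists x.
by rewrite ltrDl ltr01.
Qed.

Lemma sup_norm_ub f x : `|f x| <= sup_norm f.
Proof. by apply: ub_le_sup; [exact: sup_norm_has_ubound | exists x]. Qed.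

Lemma sup_norm_le f a : 0 <= a -> (forall x, `|f x| <= a) -> sup_norm f <= a.
Proof.
move=> a0 fa; rewrite /sup_norm.
have [->|/set0P ne] := eqVneq [set `|f x| | x in [set: K]] set0.
  by rewrite sup0.
by apply: ge_sup => // _ [x _ <-]; exact: fa.
Qed.

Lemma sup_norm_ge0 f : 0 <= sup_norm f.
Proof.
have [E|/set0P[_ [x _ _]]] := eqVneq [set `|f x| | x in [set: K]] set0.
  by rewrite /sup_norm E sup0.
exact: le_trans (sup_norm_ub f x).
Qed.

Lemma sup_normD f g : sup_norm (f + g) <= sup_norm f + sup_norm g.
Proof.
apply: sup_norm_le => [|x]; first by rewrite addr_ge0 ?sup_norm_ge0.
by apply: le_trans (ler_normD (f x) (g x)) _; rewrite lerD ?sup_norm_ub.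
Qed.

Lemma sup_norm_scale_le a f : sup_norm (a *: f) <= `|a| * sup_norm f.
Proof.
apply: sup_norm_le => [|x]; first by rewrite mulr_ge0 ?sup_norm_ge0.
by rewrite [X in `|X|]/(a * f x) normrM ler_wpM2l ?sup_norm_ub.
Qed.

Lemma sup_normZ a f : sup_norm (a *: f) = `|a| * sup_norm f.
Proof.
apply/eqP; rewrite eq_le sup_norm_scale_le /=.
have [->|a0] := eqVneq a 0; first by rewrite normr0 mul0r sup_norm_ge0.
rewrite -ler_pdivlMl ?normr_gt0// -normfV.
by rewrite -[X in sup_norm X <= _](scalerK a0) sup_norm_scale_le.
Qed.

Lemma sup_norm0_eq0 f : sup_norm f = 0 -> f = 0.
Proof.
move=> f0; apply: cspaceP => x; apply/eqP.
by rewrite -normr_le0 -f0 sup_norm_ub.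
Qed.

HB.instance Definition _ :=
  Lmodule_isNormed.Build R C sup_normD sup_normZ sup_norm0_eq0.

Lemma cspace_normE f : `|f| = sup [set `|f x| | x in [set: K]].
Proof. by []. Qed.

End CSpace.

(* [L] is a countable discrete extension of [K], where [K] is regarded as a
   subspace of [L] through the topological embedding [i]. *)
Record countable_discrete_extension (K L : topologicalType) (i : K -> L)
    : Prop := CountableDiscreteExtension {
  cde_compact : compact [set: L];
  cde_hausdorff : hausdorff_space L;
  cde_inj : injective i;
  cde_open : forall U : set K,
    open U <-> exists2 V : set L, open V & U = i @^-1` V;
  cde_countable : ~` range i #= [set: nat];
  cde_discrete : ~` range i `<=` isolated (~` range i)
}.

Section ExtensionOperators.
Context {R : realType} {K L : topologicalType}.
Context (cK : compact [set: K]) (cL : compact [set: L]) (i : K -> L).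
Implicit Type E : {linear cspace R cK -> cspace R cL}.

Definition bounded_operator E : Prop :=
  exists M : R, forall f, `|E f| <= M * `|f|.

(* Meaningful for bounded E only: sup is 0 on sets with no upper bound. *)
Definition operator_norm E : R := sup [set `|E f| | f in [set f | `|f| <= 1]].

Definition extension_operator E : Prop :=
  bounded_operator E /\ forall f x, E f (i x) = f x.

(* ereal_inf set0 = +oo, so the value is +oo when there is no extension
   operator. *)
Definition eta : \bar R :=
  ereal_inf [set (operator_norm E)%:E | E in extension_operator].

End ExtensionOperators.

Arguments eta R {K L} cK cL i.

(* Main.v *)
(* Let E be an extension operator of norm M < 2k+1. For x in L \ K replace the functional
   phi = (f |-> E f x) by an alternating sum nu of an odd number c <= 2k-1 of point
   evaluations. Fix a small del > 0. In a chain 0 <= g_1 <= ... <= g_m <= 1 with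
   phi(g_1) >= 1-del, phi(g_2) <= del, phi(g_3) >= 1-del, ..., the signed sum of increments has
   norm <= 1 and phi-value >= m(1-2del), so m <= 2k. Let c be the largest such m (odd, as
   phi(1) is close to 1) and t_j the infimum of those s for which some chain of length j
   vanishes beyond s; put nu(f) = f(t_1) - f(t_2) + ... + f(t_c). As x tends to a point y of
   K, phi(g) tends to g(y), so for nonincreasing f the cutoffs of f at levels
   below f(y) have phi-value near 1 and those at levels above f(y) have phi-value near 0;
   maximality of the chains then confines the t_j so that nu(f) tends to f(y).
   Monotone functions span a dense subspace of C(K), so the functionals nu
   define an extension operator of norm <= 2k-1, and no value of eta lies strictly
   between consecutive odd integers. *)
From HB Require Import structures.
Require Import Defs.
From mathcomp Require Import all_boot all_order all_algebra.
From mathcomp Require Import all_classical all_reals all_analysis.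
From mathcomp Require Import ring lra zify.

Set Implicit Arguments.
Unset Strict Implicit.
Unset Printing Implicit Defensive.

Import Order.TTheory GRing.Theory Num.Theory.
Import numFieldNormedType.Exports.

Local Open Scope classical_set_scope.
Local Open Scope ring_scope.

(** * Monotone functions on a compact line *)

Section CompactLine.
Context (d : Order.disp_t) (K : orderTopologicalType d).
Hypothesis cK : compact [set: K].

(** Totality makes the sets of points of [A] lying [r]-below an element of [A] a filter base, and a
    cluster point belongs to each of the closed rays. Keeping [r] abstract serves infima and suprema
    alike. *)
Lemma compact_extremum (r : rel K) (A : set K) :
  reflexive r -> transitive r -> total r ->
  (forall a, closed [set x | r x a]) -> A !=set0 ->
  exists2 t, closure A t & forall a, A a -> r t a.
Proof.
move=> rr rt rT rc [a0 Aa0].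
pose F := filter_from A (fun a => A `&` [set x | r x a]).
have FF : ProperFilter F.
  apply: filter_from_proper; last by move=> a Aa; exists a; split => //; exact: rr.
  apply: filter_from_filter; first by exists a0.
  move=> a b Aa Ab; have /orP[ab|ba] := rT a b.
    by exists a => // x [Ax xa]; split; split => //; exact: rt ab.
  by exists b => // x [Ax xb]; split; split => //; exact: rt ba.
have [t [_ Ft]] := cK FF filterT.
exists t => [B tB|a Aa].
  have FA : F A by exists a0 => // x [].
  exact: Ft FA tB.
apply: (rc a) => B tB.
have Fa : F [set x | r x a] by exists a => // x [].
exact: Ft Fa tB.
Qed.

Lemma compact_infimum (A : set K) : A !=set0 ->
  exists2 t, closure A t & forall a, A a -> (t <= a)%O.
Proof.
apply: (@compact_extremum (fun x y => (x <= y)%O)).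
- exact: lexx.
- exact: le_trans.
- exact: le_total.
- by move=> a; have := @lray_closed _ K a; rewrite set_itvE.
Qed.

Lemma compact_supremum (A : set K) : A !=set0 ->
  exists2 t, closure A t & forall a, A a -> (a <= t)%O.
Proof.
apply: (@compact_extremum (fun x y => (y <= x)%O)).
- exact: lexx.
- by move=> x y z xy yz; exact: le_trans yz xy.
- by move=> x y; exact: le_total.
- by move=> a; have := @rray_closed _ K a; rewrite set_itvE.
Qed.

Lemma nbhs_convex (x : K) (U : set K) : nbhs x U -> exists V : set K,
  [/\ nbhs x V, V `<=` U &
    forall a b c, V a -> V b -> (a <= c)%O -> (c <= b)%O -> V c].
Proof.
rewrite itv_nbhsE => -[I [oI xI] IU]; exists [set` I]; split => //.
- by exists I.
- move: I {oI xI IU} => [l u] a b c /=.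
  rewrite !itv_boundlr => /andP[la _] /andP[_ bu] ac cb; apply/andP; split.
    by apply: le_trans la _; rewrite bnd_simp.
  by apply: le_trans _ bu; rewrite bnd_simp.
Qed.

Variable R : realType.

Definition running_sup (u : K -> R) (x : K) : R :=
  sup [set u y | y in [set y | (y <= x)%O]].

Lemma running_sup_le (u : K -> R) x m :
  (forall y, (y <= x)%O -> u y <= m) -> running_sup u x <= m.
Proof. by move=> um; apply: ge_sup; [exists (u x), x => /=|move=> _ [y yx <-]; exact: um]. Qed.

Lemma running_sup_ge (u : K -> R) x y :
  continuous u -> (y <= x)%O -> u y <= running_sup u x.
Proof.
move=> cu yx; apply: ub_le_sup; last by exists y.
exists (sup_norm (to_cspace cK cu)) => _ [z _ <-].
exact: le_trans (ler_norm _) (sup_norm_ub (to_cspace cK cu) z).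
Qed.

(** Inside a convex neighbourhood on which [u] varies little, moving right adjoins to the supremum
    only values of [u] taken in that neighbourhood. *)
Lemma running_sup_continuous (u : K -> R) : continuous u -> continuous (running_sup u).
Proof.
move=> cu.
have uS x y : (y <= x)%O -> u y <= running_sup u x by exact: running_sup_ge.
move=> x; apply/cvgrPdist_le => e e0.
have e4 : 0 < e / 2 by lra.
have /nbhs_convex[V [Vx VU Vc]] :
    nbhs x [set y | `|u x - u y| <= e / 2].
  by have /cvgrPdist_le := cu x; exact.
have Vxx : V x by exact: nbhs_singleton.
apply: (filterS _ Vx) => y Vy.
have uV z : V z -> `|u x - u z| <= e / 2 by move/VU.
have step a b : V a -> V b -> (a <= b)%O -> `|running_sup u b - running_sup u a| <= e.
  move=> Va Vb ab; rewrite ger0_norm ?subr_ge0; last first.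
    by apply: running_sup_le => z za; apply: uS; exact: le_trans ab.
  rewrite lerBlDr; apply: running_sup_le => z zb; have [za|az] := leP z a.
    by have := uS _ _ za; lra.
  have := uV _ (Vc _ _ _ Va Vb (ltW az) zb); have := uV _ Va.
  by have := uS a a (lexx _); rewrite !ler_norml; lra.
have [xy|/ltW yx] := leP x y; last exact: step.
by rewrite distrC; exact: step.
Qed.

(** Take one minus the running supremum of a Urysohn function for the two closed rays: the supremum
    forces monotonicity and keeps the values on the rays. *)
Lemma monotone_urysohn (a b : K) : (a < b)%O -> exists h : K -> R,
  [/\ continuous h, {homo h : x y / (x <= y)%O >-> y <= x},
      forall x, 0 <= h x <= 1,
      forall x, (x <= a)%O -> h x = 1 & forall x, (b <= x)%O -> h x = 0].
Proof.
move=> ab; have nK : normal_space K by exact: (compact_normal order_hausdorff).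
have ca := @lray_closed _ K a; have cb := @rray_closed _ K b.
have [|u [cu ua ub u01]] :=
  @urysohn_ext_itv K R nK _ _ 0 1 ca cb _ ltr01.
  rewrite -subset0 => x []; rewrite !set_itvE /= => xa bx.
  by have := le_lt_trans xa (lt_le_trans ab bx); rewrite ltxx.
rewrite !set_itvE in ua ub.
have u0 x : (x <= a)%O -> u x = 0 by move=> xa; apply: ua; exists x.
have u1 x : (b <= x)%O -> u x = 1 by move=> xa; apply: ub; exists x.
have {}u01 x : 0 <= u x <= 1.
  by have /= := u01 (u x) (ex_intro2 _ _ x I erefl); rewrite in_itv.
have uS x y : (y <= x)%O -> u y <= running_sup u x by exact: running_sup_ge.
have S1 x : running_sup u x <= 1 by apply: running_sup_le => y _; have /andP[] := u01 y.
exists (fun x => 1 - running_sup u x); split.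
- move=> x; apply: cvgB; first exact: cvg_cst.
  exact: running_sup_continuous cu x.
- move=> x y xy; rewrite lerD2l lerN2; apply: running_sup_le => z zx.
  by apply: uS; exact: le_trans xy.
- by move=> x; have := S1 x; have := uS x x (lexx _); have := u01 x; lra.
- move=> x xa; have : running_sup u x <= 0.
    by apply: running_sup_le => y yx; rewrite u0//; exact: le_trans xa.
  by have := uS x x (lexx _); rewrite u0//; lra.
- move=> x bx; have := S1 x; have := uS x x (lexx _).
  by rewrite u1//; lra.
Qed.


Local Notation C := (cspace R cK).

(** [S] stands for any linear class containing the monotone functions. An approximant is built from
    left to right, corrected by a monotone step across each interval of small oscillation; a
    supremum argument carries it to the right end. *)
Lemma monotone_span_dense (S : C -> Prop) :
  (forall h : C, {homo h : x y / (x <= y)%O >-> y <= x} ->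
     (forall x, 0 <= h x <= 1) -> S h) ->
  (forall a f g, S f -> S g -> S (a *: f + g)) ->
  forall (f : C) (e : R), 0 < e ->
  exists2 g, S g & forall x, `|f x - g x| <= e.
Proof.
move=> Smono Slin f e e0.
have S0 : S 0 by apply: Smono => // x; rewrite lexx ler01.
pose one : C := to_cspace cK (@cst_continuous K R 1).
have S1 : S one by apply: Smono => x; rewrite to_cspaceE ?ler01 ?lexx.
have [[x0 _]|K0] := pselect (exists x : K, True); last first.
  by exists 0 => // x; case: K0; exists x.
(* The approximant is frozen at the value [f x] from [x] on, so it can be continued from [a] to [b]
   by adding [(f b - f a) (1 - h)]. *)
pose P x := exists g, [/\ S g, forall y, (y <= x)%O -> `|f y - g y| <= e &
  forall y, (x <= y)%O -> g y = f x].
have step a b : (a < b)%O -> P a ->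
    (forall y, (a < y)%O -> (y < b)%O -> `|f a - f y| <= e /\ `|f b - f y| <= e) ->
    P b.
  move=> ab [g [Sg gl gr]] osc.
  have [h [ch hmono h01 h1 h0]] := monotone_urysohn ab.
  exists ((f b - f a) *: one + ((f a - f b) *: to_cspace cK ch + g)).
  have gE y : ((f b - f a) *: one + ((f a - f b) *: to_cspace cK ch + g) : C) y =
    (f b - f a) * 1 + ((f a - f b) * h y + g y) by [].
  split.
  - by apply: (Slin) => //; apply: (Slin) => //; exact: Smono.
  - move=> y yb; rewrite gE; have [ya|ay] := leP y a.
      have -> : (f b - f a) * 1 + ((f a - f b) * h y + g y) = g y.
        by rewrite h1//; ring.
      exact: gl.
    rewrite (gr y (ltW ay)); have [->|yb'] := eqVneq y b.
      by rewrite h0//; apply/ltW; rewrite (_ : _ - _ = 0) ?normr0//; ring.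
    have {}yb : (y < b)%O by rewrite lt_neqAle yb'.
    have [fa fb] := osc _ ay yb; have /andP[hy0 hy1] := h01 y.
    move: fa fb; rewrite !ler_norml => /andP[? ?] /andP[? ?].
    by apply/andP; split; nra.
  - move=> y yb; rewrite gE h0// gr; last exact/ltW/(lt_le_trans ab).
    by ring.
have [m _ mmin] := compact_infimum (ex_intro [set: K] x0 I).
have Pm : P m.
  exists (f m *: one + 0); have E y : (f m *: one + 0 : C) y = f m.
    by rewrite [LHS](_ : _ = f m * 1 + 0)// mulr1 addr0.
  split; [exact: Slin| |by []] => y ym.
  have -> : y = m by apply: le_anti; rewrite ym mmin.
  by rewrite E subrr normr0 ltW.
have [t At tub] := compact_supremum (ex_intro P m Pm).
have e2 : 0 < e / 2 by lra.
have /nbhs_convex[V [Vt VU Vc]] : nbhs t [set y | `|f t - f y| <= e / 2].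
  by have /cvgrPdist_le := @cspace_continuous _ _ _ f t; exact.
have Vtt : V t by exact: nbhs_singleton.
have osc y z : V y -> V z -> `|f y - f z| <= e.
  by move=> /VU + /VU; rewrite /= !ler_norml; lra.
have [a [Pa Va]] := At _ Vt.
have Pt : P t.
  have := tub _ Pa; rewrite le_eqVlt => /orP[/eqP<-//|at_].
  apply: (step a) => // y /ltW ay /ltW yt.
  by have Vy := Vc _ _ _ Va Vtt ay yt; split; exact: osc.
have tmax x : (x <= t)%O.
  rewrite leNgt; apply/negP => tx.
  have [[b Vb tb]|noV] := pselect (exists2 b, V b & (t < b)%O).
    have : P b.
      apply: (step t) => // y /ltW ty /ltW yb.
      by have Vy := Vc _ _ _ Vtt Vb ty yb; split; exact: osc.
    by move=> /tub; rewrite leNgt tb.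
  (* No point of [V] lies right of [t], so this infimum is an immediate successor of [t], and the
     oscillation condition on the empty interval between them is vacuous. *)
  have [b Bb bmin] := compact_infimum (ex_intro [set y | (t < y)%O] x tx).
  have tb : (t < b)%O.
    rewrite ltNge; apply/negP; rewrite le_eqVlt => /orP[/eqP bt|bt].
      by rewrite bt in Bb; have [y [ty Vy]] := Bb _ Vt; apply: noV; exists y.
    have [|y [ty yt]] := Bb [set y | (y < t)%O].
      apply: open_nbhs_nbhs; split => //.
      by have := @lray_open _ K t; rewrite set_itvE.
    by have := lt_trans ty yt; rewrite ltxx.
  have /tub : P b.
    apply: (step t) => // y ty yb.
    by have := bmin _ ty; rewrite leNgt yb.
  by rewrite leNgt tb.
by have [g [Sg gl _]] := Pt; exists g => // x; exact: gl.
Qed.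
End CompactLine.

(** * Alternating chains and the points they determine *)

Section AlternatingChains.
Context (R : realType) (d : Order.disp_t) (K : orderTopologicalType d).
Context (cK : compact [set: K]).
Local Notation C := (cspace R cK).
Implicit Types (F f g h : C) (x s : K).

Definition clamp (z : R) : R := Num.max 0 (Num.min z 1).

Lemma clamp_ge0_le1 z : 0 <= clamp z <= 1.
Proof. by rewrite /clamp; case: (leP z 1) => ?; [case: (leP 0 z)|case: (leP 0 1)] => ?; lra. Qed.

Lemma clamp_le0 z : z <= 0 -> clamp z = 0.
Proof. by move=> ?; rewrite /clamp; case: (leP z 1) => ?; [case: (leP 0 z)|case: (leP 0 1)] => ?; lra. Qed.

Lemma clamp_ge1 z : 1 <= z -> clamp z = 1.
Proof. by move=> ?; rewrite /clamp; case: (leP z 1) => ?; [case: (leP 0 z)|case: (leP 0 1)] => ?; lra. Qed.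

Lemma cutoff_continuous F (a : R) : continuous (fun x => clamp (F x - a)).
Proof.
move=> x; apply: (@continuous_max R K (cst 0) (fun y => Num.min (F y - a) 1)).
  exact: cst_continuous.
apply: (@continuous_min R K (fun y => F y - a) (cst 1)).
  by apply: cvgB; [exact: cspace_continuous|exact: cvg_cst].
exact: cst_continuous.
Qed.

(** The slice of [F] between the heights [a] and [a + 1]. Its thickness is fixed; resolution is
    gained later by scaling [F] up. *)
Definition cutoff F (a : R) : C := to_cspace cK (@cutoff_continuous F a).

Definition const_one : C := to_cspace cK (@cst_continuous K R 1).

Lemma const_oneE x : const_one x = 1. Proof. by []. Qed.

Section Functional.
Variables (phi : C -> R) (del : R).
Hypothesis phiL : forall (a : R) f g, phi (a *: f + g) = a * phi f + phi g.

Definition alternates (m : nat) (v : R) : Prop :=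
  if odd m then 1 - del <= v else v <= del.

(* The index counts the links and the function is the largest one in the chain. *)
Inductive alternating_chain : nat -> C -> Prop :=
| AlternatingNil : alternating_chain 0 0
| AlternatingCons m g h : alternating_chain m g ->
    (forall x, g x <= h x <= 1) -> alternates m.+1 (phi h) ->
    alternating_chain m.+1 h.

Lemma phi0 : phi 0 = 0.
Proof. by have := phiL 1 0 0; rewrite scaler0 addr0; lra. Qed.

Lemma alternating_chain_bounds m g : alternating_chain m g ->
  forall x, 0 <= g x <= 1.
Proof.
elim=> [x|{}m {}g h _ gb gh _ x]; first by rewrite lexx ler01.
by have := gb x; have := gh x; lra.
Qed.

Lemma alternating_chain_value m g : 0 <= del ->
  alternating_chain m g -> alternates m (phi g).
Proof. by move=> del0 [|//]; rewrite /alternates /= phi0. Qed.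

Lemma alternating_chain_prefix m h : alternating_chain m.+1 h ->
  exists2 g, alternating_chain m g & forall x, g x <= h x.
Proof.
move E : m.+1 => n H; case: H E => // {}n g {}h cg gh _ [->].
by exists g => // x; have /andP[] := gh x.
Qed.

Lemma alternating_chain_shorten m n g : alternating_chain n g -> (m <= n)%N ->
  exists g', alternating_chain m g'.
Proof.
move=> cg mn; rewrite -(subnKC mn) in cg.
elim: (n - m)%N g cg => [g|p IH g]; first by rewrite addn0; exists g.
by rewrite addnS => /alternating_chain_prefix[g' /IH].
Qed.

(* The increments of a chain are nonnegative with sum at most 1, so the signed
   sum [psi] of the increments has norm at most 1. *)
Lemma alternating_chain_variation m g : 0 <= del -> alternating_chain m g ->
  exists2 psi : C, forall x, `|psi x| <= g x &
    m%:R * (1 - 2 * del) <= phi psi.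
Proof.
move=> del0; elim=> [|{}m {}g h cg [psi psig phipsi] gh alt].
  by exists 0 => [x|]; rewrite ?phi0 ?mul0r// [X in `|X|](_ : _ = 0)// normr0.
(* With this sign a rise after an even number of links and a drop after an odd number both
   contribute at least [1 - 2 * del]. *)
pose e : R := if odd m then -1 else 1.
have e1 : `|e| = 1 by rewrite /e; case: odd; rewrite ?normrN normr1.
exists (e *: (h - g) + psi) => [x|].
  rewrite [X in `|X|](_ : _ = e * (h x - g x) + psi x)//.
  apply: le_trans (ler_normD _ _) _; rewrite normrM e1 mul1r.
  have /andP[ghx _] := gh x; have := psig x.
  by rewrite ger0_norm ?subr_ge0//; lra.
have -> : phi (e *: (h - g) + psi) = e * (phi h - phi g) + phi psi.
  rewrite phiL (_ : h - g = (-1) *: g + h); last by rewrite scaleN1r addrC.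
  by rewrite phiL; ring.
have := alternating_chain_value del0 cg; move: alt phipsi; rewrite /alternates /e.
by rewrite -natr1 /=; case: odd => /=; lra.
Qed.

Definition chain_reach m : set K :=
  [set s | exists2 g, alternating_chain m g & forall x, (s < x)%O -> g x = 0].

(** The cutoff equals 1 up to [s], beyond which the chain vanishes, so it dominates the chain and
    can serve as the next link. It vanishes beyond the last point where [F] is at least [a]. *)
Lemma alternating_chain_cutoff m s F a :
  {homo F : x y / (x <= y)%O >-> y <= x} -> 0 <= del < 1 ->
  alternates m.+1 (phi (cutoff F a)) ->
  m = 0%N \/ chain_reach m s /\ a + 1 < F s ->
  exists2 s', chain_reach m.+1 s' & a <= F s'.
Proof.
move=> Fmono del01 alt Hm.
have [g cg gF] : exists2 g, alternating_chain m g & forall x, g x <= cutoff F a x.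
  case: Hm => [->|[[g cg gs] Fs]].
    by exists 0; [exact: AlternatingNil|move=> x; have /andP[] := clamp_ge0_le1 (F x - a)].
  exists g => // x; rewrite to_cspaceE; have [xs|sx] := leP x s.
    rewrite clamp_ge1; first by have /andP[] := alternating_chain_bounds cg x.
    by have := Fmono _ _ xs; lra.
  by rewrite gs//; have /andP[] := clamp_ge0_le1 (F x - a).
have cF : alternating_chain m.+1 (cutoff F a).
  apply: AlternatingCons cg _ alt => x; rewrite gF.
  by have /andP[] := clamp_ge0_le1 (F x - a).
(* For [m = 0], if [F] stayed below [a] the cutoff would be zero, and [phi 0 = 0] is less than
   [1 - del]. *)
have [x0 Fx0] : exists x0, a <= F x0.
  apply: contrapT => noF.
  have F0 x : F x < a by rewrite ltNge; apply/negP => Fx; apply: noF; exists x.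
  case: Hm => [m0|[_ Fs]]; last by have := F0 s; lra.
  have E : cutoff F a = 0.
    by apply: cspaceP => x; rewrite to_cspaceE clamp_le0//; have := F0 x; lra.
  by move: alt; rewrite m0 E phi0 /alternates /=; lra.
have cA : closed [set x | a <= F x].
  have := @closed_ge R a; apply: closed_comp => x _; exact: cspace_continuous.
have [t tA tmax] := compact_supremum cK (ex_intro [set x | a <= F x] x0 Fx0).
exists t; last exact: cA.
exists (cutoff F a) => // x tx; rewrite to_cspaceE clamp_le0// subr_le0 leNgt.
apply/negP => /ltW /tmax; rewrite leNgt.
by rewrite tx.
Qed.

(** Here [c] is the maximal chain length and [t m] the infimum of [chain_reach m]. In the last
    clause the cutoff prolongs a chain of length [m], so maximality gives [m < c] and the new link
    bounds [t m.+1] from the right. *)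
Lemma alternating_points (M : R) (k : nat) :
  0 <= del < 1 -> M < k.*2.+1%:R * (1 - 2 * del) ->
  (forall f, (forall x, `|f x| <= 1) -> phi f <= M) ->
  1 - del <= phi const_one ->
  exists c (t : nat -> K), [/\ odd c, (c < k.*2.+1)%N,
    forall m, (0 < m < c)%N -> (t m <= t m.+1)%O &
    forall F a m, {homo F : x y / (x <= y)%O >-> y <= x} -> (m <= c)%N ->
      alternates m.+1 (phi (cutoff F a)) -> m = 0%N \/ a + 1 < F (t m) ->
      (m < c)%N /\ a <= F (t m.+1)].
Proof.
move=> /[dup] del01 /andP[del0 del1] Mk phiM phi1.
have short m g : alternating_chain m g -> (m < k.*2.+1)%N.
  move=> cg; rewrite ltnNge; apply/negP => km.
  have [g' cg'] := alternating_chain_shorten cg km.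
  have [psi psig] := alternating_chain_variation del0 cg'.
  have := phiM psi (fun x => le_trans (psig x) (proj2 (andP (alternating_chain_bounds cg' x)))).
  by lra.
have [x0 _] : exists x0 : K, True.
  apply: contrapT => K0; have E : const_one = 0.
    by apply: cspaceP => x; case: K0; exists x.
  by move: phi1; rewrite E phi0; lra.
pose P m := exists g, alternating_chain m g.
have [c [[g cg] ncS]] : exists c, P c /\ ~ P c.+1.
  suff H n : ~ P n -> exists c, P c /\ ~ P c.+1.
    by apply: (H k.*2.+1) => -[g /short]; rewrite ltnn.
  elim: n => [[]|n IH nP]; first by exists 0; exact: AlternatingNil.
  by have [Pn|/IH//] := pselect (P n); exists n.
(* A chain of even length could be prolonged by the constant 1. *)
have oddc : odd c.
  apply/negPn/negP => evc; apply: ncS; exists const_one.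
  apply: (AlternatingCons cg) => [x|]; last by rewrite /alternates /= evc.
  by have /andP[_ gx] := alternating_chain_bounds cg x; rewrite gx const_oneE lexx.
have [top _ topP] := compact_supremum cK (ex_intro [set: K] x0 I).
have /choice[t tP] : forall m, exists t : K, (m <= c)%N ->
    closure (chain_reach m) t /\ forall s, chain_reach m s -> (t <= s)%O.
  move=> m; have [mc|_] := boolP (m <= c)%N; last by exists x0.
  have [g' cg'] := alternating_chain_shorten cg mc.
  have [|t ct tlb] := @compact_infimum _ _ cK (chain_reach m); last by exists t.
  (* Nothing lies beyond the greatest point, so every chain reaches it. *)
  by exists top; exists g' => // x; rewrite ltNge topP.
exists c, t; split => //; first exact: short cg.
- move=> m /andP[_ mc]; have [cl lb] := tP _ mc.
  have [_ lb'] := tP _ (ltnW mc).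
  apply: contrapT => /negP; rewrite -ltNge => tm.
  have [|s [[h ch hs] st]] := cl [set s | (s < t m)%O].
    apply: open_nbhs_nbhs; split => //.
    by have := @lray_open _ K (t m); rewrite set_itvE.
  have [h' ch' hh'] := alternating_chain_prefix ch.
  have /lb' : chain_reach m s.
    exists h' => // x /hs hx0; have := hh' x.
    by have := alternating_chain_bounds ch' x; rewrite hx0; lra.
  by rewrite leNgt st.
- move=> F a m Fmono mc alt Hm.
  (* The infimum [t m] need not be attained; the strict inequality is an open condition and passes
     to a nearby point of [chain_reach m]. *)
  have [s Hs] : exists s, m = 0%N \/ chain_reach m s /\ a + 1 < F s.
    case: Hm => [m0|Ftm]; first by exists x0; left.
    have [cl _] := tP _ mc.
    have [|s [ms Fs]] := cl [set x | a + 1 < F x]; last by exists s; right.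
    apply: open_nbhs_nbhs; split => //; rewrite /=.
    apply: (@open_comp _ _ (F : K -> R) [set y | a + 1 < y]); last exact: open_gt.
    by move=> x _; exact: cspace_continuous.
  have [s' rs' Fs'] := alternating_chain_cutoff Fmono del01 alt Hs.
  have mc' : (m < c)%N.
    rewrite ltn_neqAle mc andbT; apply/eqP => E; apply: ncS; rewrite -E.
    by case: rs' => h ch _; exists h.
  by split=> //; apply: le_trans Fs' _; apply: Fmono; apply: (tP _ mc').2.
Qed.

End Functional.

(** * Alternating sums of point values *)

Definition alternating_sum (c : nat) (t : nat -> K) (f : K -> R) : R :=
  \sum_(i < c) (-1) ^+ i * f (t i.+1).

(** By induction, the partial sum of the first [2p + 1] terms is within [e (2p + 1)] of the maximum
    of its last value and [y]: each further pair of terms costs [2 e], one for each of the odd and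
    even conditions. The final condition replaces that maximum by [y] at the cost of one more
    [e]. *)
Lemma alternating_sum_estimate (c : nat) (v : nat -> R) (y e : R) : odd c -> 0 <= e ->
  (forall m, (0 < m < c)%N -> v m.+1 <= v m) ->
  y - e <= v 1 ->
  (forall m, (0 < m < c)%N -> ~~ odd m -> Num.min (v m) y - e <= v m.+1) ->
  (forall m, (0 < m < c)%N -> odd m -> v m - e <= Num.max (v m.+1) y) ->
  v c <= y + e ->
  `|\sum_(i < c) (-1) ^+ i * v i.+1 - y| <= e * c.+1%:R.
Proof.
move=> oddc e0 vdec vfirst veven vodd vlast.
have minmax a b : Num.min a b = a + b - Num.max a b :> R by case: leP => _; lra.
have H p : (p.*2.+1 <= c)%N ->
    `|\sum_(i < p.*2.+1) (-1) ^+ i * v i.+1 - Num.max (v p.*2.+1) y| <= e * p.*2.+1%:R.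
  elim: p => [_|p IH pc].
    rewrite big_ord_recl big_ord0 expr0 ler_norml /=.
    by rewrite -[e * _]/(e * 1) mulr1; case: (leP (v 1) y) => ?; lra.
  have {}IH := IH (ltnW (ltnW pc)).
  have o1 : odd p.*2.+1 by rewrite /= odd_double.
  have o2 : ~~ odd p.*2.+2 by rewrite /= odd_double.
  have d1 := vdec p.*2.+1 (ltnW pc); have d2 := vdec p.*2.+2 pc.
  have b1 := vodd p.*2.+1 (ltnW pc) o1; have b2 := veven p.*2.+2 pc o2.
  rewrite doubleS 2!big_ord_recr /= !exprS -!mul2n exprM sqrrN expr1n expr1n !mul2n.
  have -> : p.*2.+3%:R = p.*2.+1%:R + 2 :> R by rewrite -natrD addn2.
  rewrite mulrDr.
  move: IH b1 b2 d1 d2; rewrite !ler_norml !minmax.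
  by case: (leP (v p.*2.+1) y) => ?; case: (leP (v p.*2.+2) y) => ?;
    case: (leP (v p.*2.+3) y) => ?; lra.
have [p cE] : exists p, c = p.*2.+1.
  by exists c./2; rewrite -[LHS]odd_double_half oddc.
have := H p; rewrite -cE leqnn => /(_ isT).
rewrite -natr1 mulrDr !ler_norml.
by case: (leP (v c) y) => ?; lra.
Qed.

(** Were a condition of [alternating_sum_estimate] to fail by more than 2, an integer slice of [F]
    would fit in the margin. Its [phi]-value is near 0 or 1 according to the side of [y], and the
    property of the points then gives a contradiction. The error does not depend on [N]. *)
Lemma alternating_sum_approx (phi : C -> R) (del : R) (c : nat) (t : nat -> K)
    (N : nat) F (y : R) :
  odd c -> (forall m, (0 < m < c)%N -> (t m <= t m.+1)%O) ->
  {homo F : x y / (x <= y)%O >-> y <= x} ->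
  (forall (a : R) m, (m <= c)%N ->
     alternates del m.+1 (phi (cutoff F a)) -> m = 0%N \/ a + 1 < F (t m) ->
     (m < c)%N /\ a <= F (t m.+1)) ->
  (forall x, 0 <= F x <= N%:R) -> 0 <= y <= N%:R ->
  (forall j, (j < N)%N -> `|phi (cutoff F j%:R) - clamp (y - j%:R)| <= del) ->
  `|alternating_sum c t F - y| <= 2 * c.+1%:R.
Proof.
move=> oddc tmono Fmono tF FN yN phiF.
have step m w : (m <= c)%N -> 0 <= w -> w + 2 < N%:R -> m = 0%N \/ w + 2 < F (t m) ->
    (if odd m then y <= w else w + 2 < y) -> (m < c)%N /\ w < F (t m.+1).
  move=> mc w0 wN Hm ym.
  (* The first integer above [w]: the slice from [j] to [j + 1] lies above [w] and does not pass
     [w + 2], whence the margin 2. *)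
  set j := (Num.truncn w).+1.
  have [jw wj] : j%:R <= w + 1 /\ w < j%:R.
    by have := truncn_itv w0; rewrite /j -natr1; lra.
  have jN : (j < N)%N by rewrite -(ltr_nat R); lra.
  have alt : alternates del m.+1 (phi (cutoff F j%:R)).
    have := phiF j jN; rewrite /alternates /= ler_norml; move: ym.
    case: odd => /= ym; first by rewrite clamp_le0; lra.
    by rewrite clamp_ge1; lra.
  have [|mc' Fj] := tF j%:R m mc alt.
    by case: Hm => [|Fm]; [left|right; lra].
  by split=> //; lra.
have F0 m : 0 <= F (t m) by have /andP[] := FN (t m).
apply: (@alternating_sum_estimate c (fun m => F (t m)) y 2) => //.
- by move=> m mc; apply: Fmono; exact: tmono.
- rewrite leNgt; apply/negP => H.
  have wy : F (t 1%N) + 2 < y by lra.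
  have wN : F (t 1%N) + 2 < N%:R by lra.
  have [_] := step 0%N _ (leq0n c) (F0 1%N) wN (or_introl erefl) wy.
  by rewrite ltxx.
- move=> m /andP[m0 mc] evm; rewrite leNgt; apply/negP => H.
  have [wF wy] : F (t m.+1) + 2 < F (t m) /\ F (t m.+1) + 2 < y.
    by move: H; case: (leP (F (t m)) y) => ?; lra.
  have wN : F (t m.+1) + 2 < N%:R by lra.
  have := step m _ (ltnW mc) (F0 m.+1) wN (or_intror wF).
  by rewrite (negbTE evm) ltxx => /(_ wy)[].
- move=> m /andP[m0 mc] oddm; rewrite leNgt; apply/negP; set w := Num.max _ _ => H.
  have [w1 w2] : F (t m.+1) <= w /\ y <= w by rewrite /w; case: (leP (F (t m.+1)) y) => ?; lra.
  have /andP[_ Fm] := FN (t m).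
  have wF : w + 2 < F (t m) by lra.
  have w0 : 0 <= w by lra.
  have := step m w (ltnW mc) w0 (lt_le_trans wF Fm) (or_intror wF).
  by rewrite oddm ltNge w1 => /(_ w2)[].
- rewrite leNgt; apply/negP => wF; have /andP[_ Fm] := FN (t c).
  have y0 : 0 <= y by lra.
  have := step c y (leqnn c) y0 (lt_le_trans wF Fm) (or_intror wF).
  by rewrite oddc ltnn => /(_ (lexx _))[].
Qed.

End AlternatingChains.

(** * Countable discrete extensions *)

Section ExtensionTopology.
Context (K L : topologicalType) (i : K -> L).
Hypothesis cK : compact [set: K].
Hypothesis ext : countable_discrete_extension i.

Lemma cde_continuous : continuous i.
Proof.
by apply/continuousP => U oU; apply/(cde_open ext); exists U.
Qed.

Lemma cde_closed_range : closed (range i).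
Proof.
apply: compact_closed; first exact: cde_hausdorff ext.
by apply: continuous_compact => //; apply: continuous_subspaceT; exact: cde_continuous.
Qed.

(** Isolation is given relative to the complement of [range i], which is open because the compact
    image is closed. *)
Lemma cde_nbhs_set1 x : ~ range i x -> nbhs x [set x].
Proof.
move=> nx; have [_ [V Vx VE]] := cde_discrete ext nx.
rewrite -VE; apply: filterI => //; apply: open_nbhs_nbhs; split => //.
exact/closed_openC/cde_closed_range.
Qed.

(** Otherwise [L] would be an infinite compact space of isolated points, where the cofinite filter
    has no cluster point. *)
Lemma cde_nonempty : exists x : K, True.
Proof.
apply: contrapT => K0.
have nr x : ~ range i x by move=> [y _ _]; apply: K0; exists y.
have rT : ~` range i = [set: L] by apply/seteqP; split => // x _; exact: nr.
have infL : infinite_set [set: L].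
  by move=> finL; apply: infinite_nat; rewrite -(eq_finite_set (cde_countable ext)) rT.
pose F := filter_from (@finite_set L) setC.
have FF : ProperFilter F.
  apply: filter_from_proper => [|A finA].
    apply: filter_from_filter => [|A B fA fB]; first by exists set0.
    by exists (A `|` B); [rewrite finite_setU|rewrite setCU].
  apply/set0P/eqP => A0; apply: infL.
  by rewrite -[setT]setC0 -A0 setCK.
have [t [_ Ft]] := cde_compact ext FF filterT.
have [||x [] //] := Ft (~` [set t]) [set t]; last exact: cde_nbhs_set1.
by exists [set t] => //; exact: finite_set1.
Qed.

End ExtensionTopology.

(** * Linear maps and the operator norm *)

Section LinearOfFun.
Context (R : pzRingType) (A B : lmodType R) (f : A -> B) (lf : linear f).

Definition linear_copy (_ : linear f) : A -> B := f.
HB.instance Definition _ := GRing.isLinear.Build R A B *:%R (linear_copy lf) lf.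

Lemma linear_of_fun : exists g : {linear A -> B}, forall x, g x = f x.
Proof. by exists (linear_copy lf). Qed.

End LinearOfFun.

Section OperatorNorm.
Context (R : realType) (K L : topologicalType).
Context (cK : compact [set: K]) (cL : compact [set: L]).
Implicit Type E : {linear cspace R cK -> cspace R cL}.

Lemma operator_norm_bound E f : bounded_operator E -> `|E f| <= operator_norm E * `|f|.
Proof.
move=> [M EM].
have ub : has_ubound [set `|E f| | f in [set f | `|f| <= 1]].
  exists `|M| => _ [g /= g1 <-]; apply: le_trans (EM g) _.
  apply: le_trans (ler_norm _) _; rewrite normrM normr_id.
  by rewrite ler_piMr.
have [->|f0] := eqVneq f 0; first by rewrite linear0 !normr0 mulr0.
have fgt0 : 0 < `|f| by rewrite normr_gt0.
rewrite -ler_pdivrMr// mulrC -[X in X * _]gtr0_norm ?invr_gt0// -normrZ -linearZ.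
apply: ub_le_sup => //; exists (`|f|^-1 *: f) => //=.
by rewrite normrZ normfV normr_id mulVf// gt_eqF.
Qed.

Lemma operator_norm_le E M : 0 <= M -> (forall f, `|E f| <= M * `|f|) ->
  operator_norm E <= M.
Proof.
move=> M0 EM; apply: ge_sup => [|_ [g /= g1 <-]]; first by exists `|E 0|, 0 => //=; rewrite normr0.
by apply: le_trans (EM g) _; rewrite ler_piMr.
Qed.

End OperatorNorm.

(** * Rounding an extension operator *)

Section Rounding.
Context (R : realType) (d : Order.disp_t) (K : orderTopologicalType d).
Context (cK : compact [set: K]).
Local Notation C := (cspace R cK).

Lemma alternating_sum_linear c (t : nat -> K) (a : R) (f g : K -> R) :
  alternating_sum c t (fun x => a * f x + g x) =
  a * alternating_sum c t f + alternating_sum c t g.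
Proof.
rewrite /alternating_sum mulr_sumr -big_split /=.
by apply: eq_bigr => j _; rewrite mulrDr mulrCA.
Qed.

Lemma alternating_sum_le c (t : nat -> K) (f : K -> R) (b : R) :
  (forall x, `|f x| <= b) -> `|alternating_sum c t f| <= c%:R * b.
Proof.
move=> fb; apply: le_trans (ler_norm_sum _ _ _) _.
apply: (@le_trans _ _ (\sum_(j < c) b)); last by rewrite sumr_const card_ord mulr_natl.
by apply: ler_sum => j _; rewrite normrM normrX normrN normr1 expr1n mul1r.
Qed.

Context (L : topologicalType) (i : K -> L) (ext : countable_discrete_extension i).
Variable E : {linear C -> cspace R (cde_compact ext)}.
Hypothesis Ei : forall f x, E f (i x) = f x.
Variables (k : nat) (M : R).
Hypotheses (EM : forall f, `|E f| <= M * `|f|) (M0 : 0 <= M) (Mk : M < k.*2.+1%:R).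

(* Small enough that [M < (2k + 1) (1 - 2 gap)]. *)
Let gap : R := (k.*2.+1%:R - M) / (4 * k.*2.+1%:R).

Let q0 : 0 < k.*2.+1%:R :> R. Proof. by rewrite ltr0n. Qed.

Let gapE : 4 * k.*2.+1%:R * gap = k.*2.+1%:R - M.
Proof. by rewrite /gap mulrCA mulfV ?mulr1// mulf_neq0// gt_eqF. Qed.

Let gap_gt0 : 0 < gap.
Proof. by rewrite /gap divr_gt0 ?mulr_gt0 ?subr_gt0. Qed.

Let gap_lt1 : 0 <= gap < 1.
Proof.
rewrite ltW//= /gap ltr_pdivrMr ?mulr_gt0// mul1r.
by move: q0 M0; lra.
Qed.

Let Mgap : M < k.*2.+1%:R * (1 - 2 * gap).
Proof. by have := gapE; have := Mk; lra. Qed.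

Let good (x : L) (ct : nat * (nat -> K)) : Prop :=
  [/\ forall m, (0 < m < ct.1)%N -> (ct.2 m <= ct.2 m.+1)%O &
    forall (F : C) (a : R) m, {homo F : x y / (x <= y)%O >-> y <= x} -> (m <= ct.1)%N ->
      alternates gap m.+1 (E (cutoff F a) x) -> m = 0%N \/ a + 1 < F (ct.2 m) ->
      (m < ct.1)%N /\ a <= F (ct.2 m.+1)].

(** Parity and length must be controlled at every [x] to bound the norm. The threshold property
    matters only near the image of [K], where [E] sends the constant 1 close to 1; elsewhere a
    single evaluation serves. *)
Let atoms_exist (x : L) : exists ct : nat * (nat -> K),
  [/\ odd ct.1, (ct.1 < k.*2.+1)%N & 1 - gap <= E (const_one R cK) x -> good x ct].
Proof.
have [high|nhigh] := pselect (1 - gap <= E (const_one R cK) x); last first.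
  have [y _] := cde_nonempty cK ext.
  exists (1%N, fun=> y); split => //=.
  (* The length 1 is allowed only if [k] is positive: [k = 0] would give [M < 1], yet the constant 1
     is extended with value 1 on the image of [K]. *)
  rewrite ltnS double_gt0; case: k Mk => //; rewrite -[0.*2.+1%:R]/(1 : R) => M1.
  have : `|E (const_one R cK) (i y)| <= M * 1.
    apply: le_trans (sup_norm_ub _ _) _; apply: le_trans (EM _) _.
    apply: ler_wpM2l => //; apply: sup_norm_le => // z.
    by rewrite const_oneE normr1.
  by rewrite Ei [X in `|X|](_ : _ = 1)// normr1 => ?; exfalso; lra.
have phiL (a : R) (f g : C) : E (a *: f + g) x = a * E f x + E g x.
  by rewrite linearP.
have phiM (f : C) : (forall z, `|f z| <= 1) -> E f x <= M.
  move=> f1; apply: le_trans (ler_norm _) _; apply: le_trans (sup_norm_ub _ _) _.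
  apply: le_trans (EM _) _; apply: le_trans (ler_wpM2l M0 (sup_norm_le ler01 f1)) _.
  by rewrite mulr1.
have [c [t [oc ck tm tF]]] := alternating_points phiL gap_lt1 Mgap phiM high.
by exists (c, t); split.
Qed.

(** The new operator keeps [E] on the image of [K] and uses the alternating sums elsewhere. An odd
    [c < 2k + 1] is at most [2k - 1], which bounds the norm; continuity at the image passes from
    monotone functions to their span and then to uniform limits. *)
Lemma rounded_operator : exists E' : {linear C -> cspace R (cde_compact ext)},
  (forall f x, E' f (i x) = f x) /\ forall f, `|E' f| <= k.*2.-1%:R * `|f|.
Proof.
have /choice[ct ctP] := atoms_exist.
pose nu x (f : K -> R) := alternating_sum (ct x).1 (ct x).2 f.
have ctk x : (ct x).1%:R <= k.*2.-1%:R :> R.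
  by have [oc ck _] := ctP x; rewrite ler_nat; lia.
have k1 : 1 <= k.*2.-1%:R :> R.
  have [y _] := cde_nonempty cK ext; apply: le_trans (ctk (i y)).
  by have [oc _ _] := ctP (i y); rewrite ler1n; case: (ct (i y)).1 oc.
pose q : R := k.*2.-1%:R.
have nearE (f : C) y e : 0 < e -> \forall x \near i y, `|f y - E f x| <= e.
  move=> e0; have /cvgrPdist_le/(_ _ e0) := @cspace_continuous _ _ _ (E f) (i y).
  have fE : f y = E f (i y) by exact: esym (Ei f y).
  by apply: filterS => x; rewrite fE.
pose near_eval (f : C) := forall y e, 0 < e ->
  \forall x \near i y, ~ range i x -> `|nu x f - f y| <= e.
have near_mono (f : C) : {homo f : x y / (x <= y)%O >-> y <= x} ->
    (forall x, 0 <= f x <= 1) -> near_eval f.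
  move=> fmono f01 y e e0.
  (* The error [2 (c + 1)] for [N f] is at most [2 (q + 1)], hence at most [e] after division by
     [N]. *)
  pose N := (Num.truncn (2 * (q + 1) / e)).+1.
  have Ne : 2 * (q + 1) <= N%:R * e.
    by rewrite -ler_pdivrMr//; apply/ltW/truncnS_gt.
  have N0 : 0 < N%:R :> R by rewrite ltr0n.
  pose F : C := N%:R *: f.
  have FE x : F x = N%:R * f x by [].
  have near1 : \forall x \near i y, 1 - gap <= E (const_one R cK) x.
    apply: filterS (nearE (const_one R cK) y _ gap_gt0) => x.
    by rewrite [X in `|X - _|](_ : _ = 1)// ler_norml; lra.
  (* Only the [N] integer levels matter, so finitely many neighbourhoods are intersected. *)
  have nearF : \forall x \near i y, forall j : 'I_N,
      `|E (cutoff F j%:R) x - clamp (N%:R * f y - j%:R)| <= gap.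
    apply: filter_forall => j.
    apply: filterS (nearE (cutoff F j%:R) y _ gap_gt0) => x.
    by rewrite [X in `|X - _|](_ : _ = clamp (N%:R * f y - j%:R))// distrC.
  apply: filterS2 near1 nearF => x x1 xF _.
  have [oc ck /(_ x1)[tm tF]] := ctP x.
  have Nf z : 0 <= N%:R * f z <= N%:R.
    by have /andP[f0 f1] := f01 z; rewrite mulr_ge0 ?(ltW N0)//= ler_piMr// ltW.
  have Fmono : {homo F : x y / (x <= y)%O >-> y <= x}.
    by move=> u v uv; rewrite !FE ler_pM2l//; exact: fmono.
  have := @alternating_sum_approx _ _ _ cK (fun g => E g x) gap _ (ct x).2 N F
    (N%:R * f y) oc tm Fmono (fun a m => tF F a m Fmono) Nf (Nf y)
    (fun j jN => xF (Ordinal jN)).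
  have -> : alternating_sum (ct x).1 (ct x).2 F = N%:R * nu x f.
    rewrite /nu (_ : (F : K -> R) = fun z => N%:R * f z + 0); last first.
      by apply/funext => z; rewrite addr0.
    rewrite alternating_sum_linear [X in _ + X](_ : _ = 0) ?addr0//.
    by rewrite /alternating_sum big1// => j _; rewrite mulr0.
  rewrite -mulrBr normrM gtr0_norm// -(natr1 (ct x).1) => H.
  rewrite -(ler_pM2l N0); apply: le_trans H _; apply: le_trans Ne.
  by rewrite ler_pM2l// lerD2r; exact: ctk.
have near_lin a (f g : C) : near_eval f -> near_eval g -> near_eval (a *: f + g).
  move=> nf ng y e e0.
  have a1 : 0 < `|a| + 1 by rewrite ltr_pwDr.
  have e1 : 0 < e / 2 / (`|a| + 1) by rewrite !divr_gt0.
  have e2 : 0 < e / 2 by rewrite divr_gt0.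
  apply: filterS2 (nf y _ e1) (ng y _ e2) => x fx gx xi.
  have {}fx := fx xi; have {}gx := gx xi.
  rewrite (_ : nu x _ = a * nu x f + nu x g); last exact: alternating_sum_linear.
  rewrite [X in _ - X](_ : _ = a * f y + g y)//.
  rewrite (_ : _ - _ = a * (nu x f - f y) + (nu x g - g y)); last by ring.
  apply: le_trans (ler_normD _ _) _; rewrite [leRHS](splitr e); apply: lerD => //.
  rewrite normrM; apply: (@le_trans _ _ ((`|a| + 1) * (e / 2 / (`|a| + 1)))).
    by apply: ler_pM => //; lra.
  by rewrite mulrC divfK// gt_eqF.
have near_all f : near_eval f.
  move=> y e e0.
  (* Replacing [f] by [g] costs at most [q] times this amount under [nu x] and once more under
     evaluation at [y], together [e / 2]. *)
  have e1 : 0 < e / (2 * (q + 1)) by rewrite divr_gt0// mulr_gt0// /q; lra.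
  have e2 : 0 < e / 2 by rewrite divr_gt0.
  have [g ng fg] := monotone_span_dense near_mono near_lin f e1.
  apply: filterS (ng y _ e2) => x + xi => /(_ xi) gx.
  have -> : nu x f - f y = nu x (fun z => f z - g z) + (nu x g - g y) - (f y - g y).
    suff -> : nu x f = nu x (fun z => f z - g z) + nu x g by ring.
    rewrite -[X in _ = X + _]mul1r -alternating_sum_linear; congr nu.
    by apply/funext => z; rewrite mul1r subrK.
  apply: le_trans (ler_normB _ _) _; apply: le_trans (lerD (ler_normD _ _) (fg y)) _.
  have nux := alternating_sum_le (ct x).1 (ct x).2 fg.
  have : (ct x).1%:R * (e / (2 * (q + 1))) <= q * (e / (2 * (q + 1))).
    by rewrite ler_pM2r//; exact: ctk.
  have : (q + 1) * (e / (2 * (q + 1))) = e / 2.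
    by field; rewrite /q; lra.
  by move: nux gx; rewrite /nu; lra.
pose G (f : C) (x : L) : R := if pselect (range i x) then E f x else nu x f.
have Gi f y : G f (i y) = f y by rewrite /G; case: pselect => [yi|[]]; [exact: Ei|exists y].
have Gc f : continuous (G f).
  move=> x; have [[y _ <-]|nx] := pselect (range i x); last first.
    apply/cvgrPdist_le => e e0; apply: filterS (cde_nbhs_set1 cK ext nx) => _ ->.
    by rewrite subrr normr0 ltW.
  apply/cvgrPdist_le => e e0; rewrite Gi.
  apply: filterS2 (near_all f y _ e0) (nearE f y _ e0) => z nz Ez.
  by rewrite /G; case: pselect => [//|zi]; rewrite distrC; exact: nz.
have Glin : linear (fun f => to_cspace (cde_compact ext) (Gc f)).
  move=> a f g; apply: cspaceP => x.
  rewrite [RHS](_ : _ = a * G f x + G g x)// to_cspaceE /G.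
  case: pselect => xi; first by rewrite linearP.
  exact: alternating_sum_linear.
have [E' E'E] := linear_of_fun Glin.
have {}E'E f x : E' f x = G f x by rewrite E'E.
exists E'; split=> [f x|f]; first exact: etrans (E'E f (i x)) (Gi f x).
apply: sup_norm_le => [|x]; first by rewrite mulr_ge0 ?ler0n.
rewrite [X in `|X|](E'E f x) /G; case: pselect => [xi|xi] /=.
  case: xi => y _ <-; rewrite [X in `|X|](Ei f y); apply: le_trans (sup_norm_ub f y) _.
  by rewrite ler_peMl ?sup_norm_ge0.
apply: le_trans (alternating_sum_le _ _ (sup_norm_ub f)) _.
by rewrite ler_wpM2r ?sup_norm_ge0.
Qed.

End Rounding.

Theorem theorem3p4 (R : realType) (d : Order.disp_t)
    (K : orderTopologicalType d) (cK : compact [set: K]%classic)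
    (L : topologicalType) (i : K -> L)
    (ext : countable_discrete_extension i) :
  (eta R cK (cde_compact ext) i < +oo)%E ->
  exists n : nat, odd n /\ eta R cK (cde_compact ext) i = (n%:R)%:E.
Proof.
move=> eta_fin; have [y _] := cde_nonempty cK ext.
have norm_ge1 (E : {linear cspace R cK -> cspace R (cde_compact ext)}) :
    extension_operator i E -> 1 <= operator_norm E.
  move=> [bE Ei]; have one1 : `|const_one R cK| <= 1.
    by apply: sup_norm_le => // z; rewrite const_oneE normr1.
  have E1 : E (const_one R cK) (i y) = 1 by exact: Ei.
  have H1 : `|E (const_one R cK) (i y)| <= operator_norm E * `|const_one R cK|.
    exact: le_trans (sup_norm_ub _ _) (operator_norm_bound _ bE).
  rewrite E1 normr1 in H1.
  have N0 : 0 <= operator_norm E.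
    rewrite leNgt; apply/negP => N0.
    have : operator_norm E * `|const_one R cK| <= 0 by rewrite nmulr_rle0.
    by lra.
  by apply: le_trans H1 _; rewrite ler_piMr.
have eta_ge1 : (1 <= eta R cK (cde_compact ext) i)%E.
  by apply: le_ereal_inf_tmp => _ [E /norm_ge1 + <-]; rewrite lee_fin.
have [r rE] : exists r : R, eta R cK (cde_compact ext) i = r%:E.
  by move: eta_fin eta_ge1; case: (eta _ _ _ _) => // r _ _; exists r.
rewrite rE in eta_fin eta_ge1 *; rewrite lee_fin in eta_ge1.
have /andP[nr rn] := truncn_itv (le_trans ler01 eta_ge1).
have n1 : (0 < Num.truncn r)%N by rewrite truncn_gt0.
(* Rounding half the integer part upwards places [r] between [2k - 1] (included) and [2k + 1]
   (excluded). *)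
pose k := uphalf (Num.truncn r).
have [k0 kr rk] : [/\ (0 < k)%N, k.*2.-1%:R <= r & r < k.*2.+1%:R].
  split; first by rewrite /k; lia.
    by apply: le_trans nr; rewrite ler_nat /k; lia.
  by apply: lt_le_trans rn _; rewrite ler_nat /k; lia.
exists k.*2.-1; split; first by lia.
(* Some extension operator therefore has norm below [2k + 1]; rounding it yields one of norm at most
   [2k - 1], so the infimum equals its lower bound [2k - 1]. *)
have : (eta R cK (cde_compact ext) i < k.*2.+1%:R%:E)%E by rewrite rE lte_fin.
move=> /ereal_inf_lt[z [E [bE Ei] zE] Ek].
rewrite -zE lte_fin in Ek.
have N0 : 0 <= operator_norm E by apply: le_trans ler01 (norm_ge1 E (conj bE Ei)).
have [E' [E'i E'k]] :=
  rounded_operator Ei (fun f => operator_norm_bound f bE) N0 Ek.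
congr EFin; apply: le_anti; rewrite kr andbT -lee_fin -rE.
apply: le_trans (ereal_inf_lbound _) _.
  by exists E'; first by split=> //; exists k.*2.-1%:R.
by rewrite lee_fin; apply: operator_norm_le.
Qed.
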